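(* Let $k\in\mathbb{N}$. (i) If $f\in{\mathsf{SF}}^{\mathrm{fin}}(\overline k)$ and $f\prec f'$ (with $f'\in{\mathsf{SF}}(\overline k)$), then there exists $f''\in{\mathsf{SF}}(\overline k)$ with $f''\,\sharp\,f'$ and $f\prec f''$. (ii) If $\Phi\in{\mathsf{SF}}(\overline k\rightarrow\overline k)$ and $\Phi\succeq\mathit{id}$, there can be no $f\in{\mathsf{SF}}(\overline k)$ with $\Phi(f)\succ f$; hence $\Phi=\mathit{id}$.
   Context: Pure types $\overline0=\mathbb{N}$, $\overline{k+1}=\overline k\rightarrow\mathbb{N}$. ${\mathsf{SF}}(\sigma)$ is the set of closed ${\mathrm{PCF}}^\Omega$ terms of type $\sigma$ modulo observational equivalence (${\mathrm{PCF}}^\Omega$: simply typed $\lambda$-calculus over $\mathbb{N}$ with constants $\underline n,\mathit{suc},\mathit{pre},\mathit{ifzero}$, $Y_\sigma$ for all $\sigma$, and $C_f$ for each partial $f:\mathbb{N}\rightharpoonup\mathbb{N}$; $M\simeq M'$ iff all closed contexts of type $\mathbb{N}$ yield the same numeral, if any); it is extensional, ${\mathsf{SF}}(\mathbb{N})\cong\mathbb{N}_\bot$, and elements of ${\mathsf{SF}}(\sigma\rightarrow\tau)$ are regarded as functions. $\preceq$ is the extensional order: $x\preceq x'$ iff $h\cdot x\sqsubseteq h\cdot x'$ for all $h\in{\mathsf{SF}}(\sigma\rightarrow\mathbb{N})$ (flat order on $\mathbb{N}_\bot$); it is pointwise at function types. $f\prec f'$ means $f\preceq f'$ and $f\ne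 f'$; $f\,\sharp\,f'$ means $f,f'$ have no upper bound w.r.t. $\preceq$. $\mathit{id}$ is the identity. Every element of ${\mathsf{SF}}$ is the observational-equivalence class of the interpretation of a closed ${\mathrm{PCF}}^\Omega$ term as a nested sequential procedure (NSP): a possibly infinite well-typed tree generated by $p::=\lambda\vec x.e$, $e::=\bot\mid n\mid\mathtt{case}\ a\ \mathtt{of}\ (i\Rightarrow e_i\mid i\in\mathbb{N})$, $a::=x\,q_0\cdots q_{r-1}$. An NSP is finite if it is a finite tree once all branches of the form $i\Rightarrow\bot$ are deleted; $f\in{\mathsf{SF}}(\sigma)$ is finite, $f\in{\mathsf{SF}}^{\mathrm{fin}}(\sigma)$, if it is represented by some finite closed NSP. *)

(* Defs.v *)
From Stdlib Require Import List Arith.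
Import ListNotations.

Inductive ty : Type := N : ty | Arr : ty -> ty -> ty.

Fixpoint pure (k : nat) : ty :=
  match k with O => N | S k' => Arr (pure k') N end.

Inductive term : Type :=
| Var : nat -> term
| Lam : ty -> term -> term
| App : term -> term -> term
| Num : nat -> term
| Suc : term
| Pre : term
| Ifz : term
| Fix : ty -> term
| Cst : (nat -> option nat) -> term.

Fixpoint lift (d c : nat) (M : term) : term :=
  match M with
  | Var n => if c <=? n then Var (n + d) else Var n
  | Lam t M1 => Lam t (lift d (S c) M1)
  | App M1 M2 => App (lift d c M1) (lift d c M2)
  | other => other
  end.

Fixpoint subst (k : nat) (P : term) (M : term) : term :=
  match M with
  | Var n => if n =? k then lift k 0 P else if k <? n then Var (pred n) else Var n
  | Lam t M1 => Lam t (subst (S k) P M1)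
  | App M1 M2 => App (subst k P M1) (subst k P M2)
  | other => other
  end.

Inductive has_type : list ty -> term -> ty -> Prop :=
| T_Var : forall G n t, nth_error G n = Some t -> has_type G (Var n) t
| T_Lam : forall G t s M, has_type (t :: G) M s -> has_type G (Lam t M) (Arr t s)
| T_App : forall G s t M1 M2,
    has_type G M1 (Arr s t) -> has_type G M2 s -> has_type G (App M1 M2) t
| T_Num : forall G n, has_type G (Num n) N
| T_Suc : forall G, has_type G Suc (Arr N N)
| T_Pre : forall G, has_type G Pre (Arr N N)
| T_Ifz : forall G, has_type G Ifz (Arr N (Arr N (Arr N N)))
| T_Fix : forall G t, has_type G (Fix t) (Arr (Arr t t) t)
| T_Cst : forall G f, has_type G (Cst f) (Arr N N).

Inductive step : term -> term -> Prop :=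
| S_beta : forall t M P, step (App (Lam t M) P) (subst 0 P M)
| S_fix : forall t M, step (App (Fix t) M) (App M (App (Fix t) M))
| S_suc : forall n, step (App Suc (Num n)) (Num (S n))
| S_pre : forall n, step (App Pre (Num n)) (Num (pred n))
| S_ifz0 : forall M P, step (App (App (App Ifz (Num 0)) M) P) M
| S_ifzS : forall n M P, step (App (App (App Ifz (Num (S n))) M) P) P
| S_cst : forall f n m, f n = Some m -> step (App (Cst f) (Num n)) (Num m)
| S_app : forall M M' P, step M M' -> step (App M P) (App M' P)
| S_suc_arg : forall M M', step M M' -> step (App Suc M) (App Suc M')
| S_pre_arg : forall M M', step M M' -> step (App Pre M) (App Pre M')
| S_cst_arg : forall f M M', step M M' -> step (App (Cst f) M) (App (Cst f) M')
| S_ifz_arg : forall M M', step M M' -> step (App Ifz M) (App Ifz M').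

Inductive steps : term -> term -> Prop :=
| steps_refl : forall M, steps M M
| steps_step : forall M M' M'', step M M' -> steps M' M'' -> steps M M''.

Definition eval (M : term) (n : nat) : Prop := steps M (Num n).

(* ---------- SF(sigma) as a setoid: closed terms modulo observational eq. ---------- *)
Definition closed (s : ty) (M : term) : Prop := has_type [] M s.

(* A closed context of type N with a hole of type s is a term C of type N
   whose only free variable (Var 0, of type s) is the hole; C[M] = subst 0 M C. *)
Definition obseq (s : ty) (M M' : term) : Prop :=
  forall C, has_type [s] C N ->
    forall n, eval (subst 0 M C) n <-> eval (subst 0 M' C) n.

(* extensional order: h.x below h.x' in the flat order on N_bot, for all h *)
Definition ext_le (s : ty) (x x' : term) : Prop :=
  forall h, closed (Arr s N) h ->
    forall n, eval (App h x) n -> eval (App h x') n.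

Definition sf_lt (s : ty) (f f' : term) : Prop :=
  ext_le s f f' /\ ~ obseq s f f'.

Definition sharp (s : ty) (f f' : term) : Prop :=
  ~ exists g, closed s g /\ ext_le s f g /\ ext_le s f' g.

Definition ident (s : ty) : term := Lam s (Var 0).

(* p ::= lambda xs. e ;  e ::= bot | n | case (x q_0 ... q_{r-1}) of branches.
   Only the finitely many non-bot branches are listed (all others are bot;
   for repeated labels the first one counts).  Variables are de Bruijn. *)
Inductive nsp_e : Type :=
| EBot : nsp_e
| ENum : nat -> nsp_e
| ECase : nat -> list nsp_p -> list (nat * nsp_e) -> nsp_e
with nsp_p : Type :=
| PLam : list ty -> nsp_e -> nsp_p.

Definition omega : term := App (Fix N) (Lam N (Var 0)).
Definition eqf (i : nat) : nat -> option nat :=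
  fun v => Some (if v =? i then 0 else 1).
Definition ifz (a b c : term) : term := App (App (App Ifz a) b) c.

Fixpoint tr_e (e : nsp_e) : term :=
  match e with
  | EBot => omega
  | ENum n => Num n
  | ECase x qs brs =>
      App (Lam N
             ((fix go (bs : list (nat * nsp_e)) : term :=
                 match bs with
                 | [] => omega
                 | (i, e') :: r => ifz (App (Cst (eqf i)) (Var 0)) (lift 1 0 (tr_e e')) (go r)
                 end) brs))
          ((fix goq (l : list nsp_p) (acc : term) : term :=
              match l with
              | [] => acc
              | q :: r => goq r (App acc (tr_p q))
              end) qs (Var x))
  end
with tr_p (p : nsp_p) : term :=
  match p with
  | PLam ts e => fold_right (fun t acc => Lam t acc) (tr_e e) ts
  end.

Definition sf_finite (s : ty) (f : term) : Prop :=
  exists p : nsp_p, closed s (tr_p p) /\ obseq s f (tr_p p).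

(* Main.v *)
Require Import Defs.
From Stdlib Require Import List Arith Lia Classical.
Import ListNotations.

(** Truncate a term at [m]: its constants keep only the numbers below [m], and its fixed point
    combinators become [m]-fold unfoldings.  Everything cut off is replaced by a default, which
    is either divergence or the number [m].  The first version lies below the original term and
    below the second version, and every terminating computation survives it once [m] is large.
    A logical relation shows that where the first version diverges, the second yields [m].

    So let a context [h] separate [f] from [f'], with [h f] divergent and [h f' = n], and let
    [m] be large.  Truncate [h] and the finite procedure for [f] with default [m], obtaining [h']
    and [f''].  Then [f] is below [f''] because a finite procedure survives truncation, while
    [h' f'' = m] and [h' f' = n < m]; hence [f''] and [f'] have no upper bound.  The identity
    contains no constants and equals its own truncation, so the same argument applied to [id]
    below [Phi] yields [h' Phi = m] and [h' Phi = n]: the identity is maximal. *)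

(** * Closed terms and simultaneous substitution *)

Fixpoint bounded (k : nat) (M : term) : Prop :=
  match M with
  | Var n => n < k
  | Lam _ A => bounded (S k) A
  | App A B => bounded k A /\ bounded k B
  | _ => True
  end.

Notation clo := (bounded 0).

Lemma bounded_weaken M : forall k k', bounded k M -> k <= k' -> bounded k' M.
Proof.
  induction M; simpl; intros; auto; try lia.
  - eapply IHM; eauto; lia.
  - intuition eauto.
Qed.

Lemma bounded_lift M : forall k c d, bounded k M -> k <= c -> lift d c M = M.
Proof.
  induction M; simpl; intros k c d H Hc; auto.
  - destruct (Nat.leb_spec c n); auto; lia.
  - f_equal. apply (IHM (S k)); auto; lia.
  - destruct H; f_equal; eauto.
Qed.

Lemma bounded_subst M : forall k c P, bounded k M -> k <= c -> subst c P M = M.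
Proof.
  induction M; simpl; intros k c P H Hc; auto.
  - destruct (Nat.eqb_spec n c); [lia|]. destruct (Nat.ltb_spec c n); auto; lia.
  - f_equal. apply (IHM (S k)); auto; lia.
  - destruct H; f_equal; eauto.
Qed.

Lemma has_type_bounded G M t : has_type G M t -> bounded (length G) M.
Proof.
  induction 1; simpl in *; auto.
  apply nth_error_Some. congruence.
Qed.

Lemma closed_clo t M : closed t M -> clo M.
Proof. apply has_type_bounded. Qed.

Lemma has_type_app_r G M t : has_type G M t -> forall G', has_type (G ++ G') M t.
Proof.
  induction 1; intros G'; try (econstructor; eauto; fail).
  - constructor. rewrite nth_error_app1; auto. apply nth_error_Some. congruence.
Qed.

Lemma closed_has_type G M t : closed t M -> has_type G M t.
Proof. intros H. apply (has_type_app_r [] M t H G). Qed.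

(* Variables below [k] are kept, and those beyond the environment become the junk value
   [Num 0], so that the result is bounded by [k] without any assumption on [M]. *)
Fixpoint msubst (k : nat) (env : list term) (M : term) : term :=
  match M with
  | Var n => if n <? k then Var n else nth (n - k) env (Num 0)
  | Lam t A => Lam t (msubst (S k) env A)
  | App A B => App (msubst k env A) (msubst k env B)
  | other => other
  end.

Lemma msubst_bounded M : forall k env, bounded k M -> msubst k env M = M.
Proof.
  induction M; simpl; intros k env H; auto.
  - destruct (Nat.ltb_spec n k); auto; lia.
  - f_equal; auto.
  - destruct H; f_equal; auto.
Qed.

Lemma msubst_clo M k env : clo M -> msubst k env M = M.
Proof. intros. apply msubst_bounded. eapply bounded_weaken; eauto; lia. Qed.

Lemma nth_clo env n : Forall (bounded 0) env -> clo (nth n env (Num 0)).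
Proof.
  intros H. destruct (nth_in_or_default n env (Num 0)) as [Hi|He].
  - rewrite Forall_forall in H; auto.
  - rewrite He; exact I.
Qed.

Lemma bounded_msubst M : forall k env, Forall (bounded 0) env -> bounded k (msubst k env M).
Proof.
  induction M; simpl; intros k env H; auto.
  destruct (Nat.ltb_spec n k); simpl; auto.
  eapply bounded_weaken; [apply nth_clo; auto|lia].
Qed.

Lemma subst_msubst M : forall k P env, clo P -> Forall (bounded 0) env ->
  subst k P (msubst (S k) env M) = msubst k (P :: env) M.
Proof.
  induction M; intros k P env HP He; simpl; auto.
  - destruct (Nat.ltb_spec n (S k)); simpl.
    + destruct (Nat.eqb_spec n k).
      * subst n. rewrite Nat.ltb_irrefl, Nat.sub_diag. eapply bounded_lift; eauto.
      * destruct (Nat.ltb_spec k n); [lia|]. destruct (Nat.ltb_spec n k); [auto|lia].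
    + destruct (Nat.ltb_spec n k); [lia|].
      replace (n - k) with (S (n - S k)) by lia. simpl.
      eapply bounded_subst; [apply nth_clo; auto|lia].
  - f_equal; auto.
  - f_equal; auto.
Qed.

Lemma msubst_lift M : forall k P env, msubst k (P :: env) (lift 1 k M) = msubst k env M.
Proof.
  induction M; intros k P env; simpl; auto.
  - destruct (Nat.leb_spec k n); simpl.
    + destruct (Nat.ltb_spec (n + 1) k); [lia|]. destruct (Nat.ltb_spec n k); [lia|].
      replace (n + 1 - k) with (S (n - k)) by lia. reflexivity.
    + destruct (Nat.ltb_spec n k); [auto|lia].
  - f_equal; auto.
  - f_equal; auto.
Qed.

(** Strengthening is needed because [tr_e] lifts each branch past the binder of the scrutinee value,
    while the induction hypotheses speak of the unlifted branch. *)
Lemma has_type_lift_inv M : forall G1 s G2 t,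
  has_type (G1 ++ s :: G2) (lift 1 (length G1) M) t -> has_type (G1 ++ G2) M t.
Proof.
  induction M; simpl; intros G1 s G2 t0 H; try (inversion H; subst; econstructor; eauto; fail).
  - destruct (Nat.leb_spec (length G1) n); inversion H; subst; constructor.
    + rewrite nth_error_app2 in * by lia.
      replace (n + 1 - length G1) with (S (n - length G1)) in * by lia. assumption.
    + rewrite nth_error_app1 in * by lia. assumption.
  - inversion H; subst. constructor. apply (IHM (t :: G1) s). assumption.
Qed.

(** * Replacing the constants of a term *)

Definition ctype (K : term) : option ty :=
  match K with
  | Num _ => Some N
  | Suc | Pre | Cst _ => Some (Arr N N)
  | Ifz => Some (Arr N (Arr N (Arr N N)))
  | Fix t => Some (Arr (Arr t t) t)
  | _ => None
  end.

Fixpoint tmap (c : term -> term) (M : term) : term :=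
  match M with
  | Var n => Var n
  | Lam t A => Lam t (tmap c A)
  | App A B => App (tmap c A) (tmap c B)
  | K => c K
  end.

(** Closed images are invariant under lifting and substitution, which is what [lift_tmap] and
    [fundamental] rely on. *)
Definition const_map (c : term -> term) : Prop :=
  forall K t, ctype K = Some t -> closed t (c K).

Lemma const_map_id : const_map (fun K => K).
Proof. intros K t H; destruct K; inversion H; constructor. Qed.

Lemma tmap_id M : tmap (fun K => K) M = M.
Proof. induction M; simpl; congruence. Qed.

Lemma has_type_tmap c G M t : const_map c -> has_type G M t -> has_type G (tmap c M) t.
Proof.
  intros Hc. induction 1; simpl; try (apply closed_has_type; apply Hc; reflexivity);
    econstructor; eauto.
Qed.

Lemma lift_tmap c : const_map c -> forall M d k, tmap c (lift d k M) = lift d k (tmap c M).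
Proof.
  intros Hc. assert (HK : forall K t d k, ctype K = Some t -> c K = lift d k (c K)).
  { intros K t d k H. symmetry. eapply bounded_lift; [eapply closed_clo, Hc, H|lia]. }
  induction M; intros d k; simpl; try (eapply HK; reflexivity); try congruence.
  destruct (k <=? n); reflexivity.
Qed.

(** * Evaluation *)

(* Numbers are bounded separately from the step count in [ev], because a single step
   [Cst f] can produce an arbitrarily large number. *)
Inductive stepb (b : nat) : term -> term -> Prop :=
| B_beta : forall t M P, stepb b (App (Lam t M) P) (subst 0 P M)
| B_fix : forall t M, stepb b (App (Fix t) M) (App M (App (Fix t) M))
| B_suc : forall n, S n < b -> stepb b (App Suc (Num n)) (Num (S n))
| B_pre : forall n, n < b -> stepb b (App Pre (Num n)) (Num (pred n))
| B_ifz0 : forall M P, 0 < b -> stepb b (App (App (App Ifz (Num 0)) M) P) M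
| B_ifzS : forall n M P, S n < b -> stepb b (App (App (App Ifz (Num (S n))) M) P) P
| B_cst : forall f n m, f n = Some m -> n < b -> m < b -> stepb b (App (Cst f) (Num n)) (Num m)
| B_app : forall M M' P, stepb b M M' -> stepb b (App M P) (App M' P)
| B_suc_arg : forall M M', stepb b M M' -> stepb b (App Suc M) (App Suc M')
| B_pre_arg : forall M M', stepb b M M' -> stepb b (App Pre M) (App Pre M')
| B_cst_arg : forall f M M', stepb b M M' -> stepb b (App (Cst f) M) (App (Cst f) M')
| B_ifz_arg : forall M M', stepb b M M' -> stepb b (App Ifz M) (App Ifz M').

Inductive ev (b : nat) : nat -> term -> nat -> Prop :=
| ev_num : forall n, n < b -> ev b 0 (Num n) n
| ev_step : forall j M M' n, stepb b M M' -> ev b j M' n -> ev b (S j) M n.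

Lemma stepb_step b M M' : stepb b M M' -> step M M'.
Proof. induction 1; constructor; auto. Qed.

Lemma stepb_mono b b' M M' : stepb b M M' -> b <= b' -> stepb b' M M'.
Proof. induction 1; intros; constructor; auto; lia. Qed.

Lemma ev_mono b b' j M n : ev b j M n -> b <= b' -> ev b' j M n.
Proof.
  induction 1; intros; econstructor; eauto using stepb_mono; lia.
Qed.

Lemma step_stepb M M' : step M M' -> exists b, stepb b M M'.
Proof.
  induction 1; try destruct IHstep as [b Hb]; try (exists b; constructor; assumption).
  - exists 0; constructor.
  - exists 0; constructor.
  - exists (S (S n)); constructor; lia.
  - exists (S n); constructor; lia.
  - exists 1; constructor; lia.
  - exists (S (S n)); constructor; lia.
  - exists (S (n + m)); constructor; auto; lia.
Qed.

Ltac nostep :=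
  match goal with
  | H : step (Num _) _ |- _ => inversion H
  | H : step (Lam _ _) _ |- _ => inversion H
  | H : step Suc _ |- _ => inversion H
  | H : step Pre _ |- _ => inversion H
  | H : step Ifz _ |- _ => inversion H
  | H : step (Cst _) _ |- _ => inversion H
  | H : step (Fix _) _ |- _ => inversion H
  | H : step (App Ifz (Num _)) _ |- _ => inversion H; clear H; subst; nostep
  | H : step (App (App Ifz (Num _)) _) _ |- _ => inversion H; clear H; subst; nostep
  end.

Lemma step_det M M1 : step M M1 -> forall M2, step M M2 -> M1 = M2.
Proof.
  induction 1; intros M2 H2; inversion H2; subst; try nostep; auto;
    try congruence; f_equal; auto.
Qed.

Lemma eval_step M M' n : step M M' -> (eval M n <-> eval M' n).
Proof.
  intros H; split; intros E.
  - inversion E; subst; [nostep|]. rewrite (step_det _ _ H _ H0). assumption.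
  - econstructor; eauto.
Qed.

Lemma steps_eval M M' n : steps M M' -> (eval M n <-> eval M' n).
Proof.
  induction 1; [tauto|]. rewrite (eval_step _ _ _ H). assumption.
Qed.

Lemma eval_num v n : eval (Num v) n <-> v = n.
Proof.
  split; [|intros <-; constructor]. intros E; inversion E; subst; auto; nostep.
Qed.

Lemma eval_fun M n n' : eval M n -> eval M n' -> n = n'.
Proof.
  unfold eval. intros H. remember (Num n) as X. induction H; subst; intros E.
  - apply eval_num in E; auto.
  - apply IHsteps; auto. apply (eval_step _ _ _ H). assumption.
Qed.

Lemma ev_eval b j M n : ev b j M n -> eval M n.
Proof.
  induction 1; [constructor|]. econstructor; eauto using stepb_step.
Qed.

Lemma eval_ev M n : eval M n -> exists b j, ev b j M n.
Proof.
  unfold eval. intros H. remember (Num n) as X. induction H; subst.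
  - exists (S n), 0. constructor; lia.
  - destruct (IHsteps eq_refl) as (b & j & E).
    destruct (step_stepb _ _ H) as (b' & Hb').
    exists (b + b'), (S j). econstructor.
    + eapply stepb_mono; eauto; lia.
    + eapply ev_mono; eauto; lia.
Qed.

Lemma ev_step_inv b j M M' n : step M M' -> ev b j M n -> exists j', j = S j' /\ ev b j' M' n.
Proof.
  intros H E; inversion E; subst; [nostep|].
  exists j0; split; auto. rewrite (step_det _ _ H _ (stepb_step _ _ _ H0)). assumption.
Qed.

Lemma steps_app M M' P : steps M M' -> steps (App M P) (App M' P).
Proof. induction 1; econstructor; eauto; constructor; auto. Qed.

Lemma steps_trans M M' M'' : steps M M' -> steps M' M'' -> steps M M''.
Proof. induction 1; auto; econstructor; eauto. Qed.

(** Groups the three strict unary primitives, so that their reductions are analysed once. *)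
Inductive delta : term -> (nat -> option nat) -> Prop :=
| delta_suc : delta Suc (fun n => Some (S n))
| delta_pre : delta Pre (fun n => Some (pred n))
| delta_cst : forall f, delta (Cst f) f.

Lemma delta_arg K f M M' : delta K f -> steps M M' -> steps (App K M) (App K M').
Proof.
  intros HK. induction 1; econstructor; eauto. destruct HK; constructor; auto.
Qed.

Lemma eval_delta_intro K f M v n : delta K f -> eval M v -> f v = Some n -> eval (App K M) n.
Proof.
  intros HK E Hf. eapply steps_trans; [eapply delta_arg; eauto|].
  econstructor; [|constructor].
  destruct HK; try (injection Hf as <-); constructor; auto.
Qed.

(** The step count and the number bound both pass to the argument; this lets [LE_delta] argue at a
    fixed index and bound. *)
Lemma ev_delta K f b j M n : delta K f -> ev b j (App K M) n ->
  exists v j', j' <= j /\ ev b j' M v /\ f v = Some n /\ v < b /\ n < b.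
Proof.
  intros HK. revert M. induction j; intros M E; inversion E; subst.
  (* A step of the application either fires the primitive on a numeral or takes place inside the
     argument. *)
  assert (HD : (exists v m, M = Num v /\ M' = Num m /\ f v = Some m /\ v < b /\ m < b)
            \/ exists M1, stepb b M M1 /\ M' = App K M1).
  { destruct HK; inversion H0; subst;
      try match goal with H : stepb _ Suc _ |- _ => inversion H
                   | H : stepb _ Pre _ |- _ => inversion H
                   | H : stepb _ (Cst _) _ |- _ => inversion H end; eauto;
      left; do 2 eexists; repeat split; eauto; try lia. }
  destruct HD as [(v & m & -> & -> & Hf & Hv & Hm)|(M1 & HM1 & ->)].
  - pose proof (ev_eval _ _ _ _ H1) as E1. apply eval_num in E1. subst m.
    exists v, 0. repeat split; auto; try lia. constructor; auto.
  - destruct (IHj _ H1) as (v & j' & Hj & E' & Hf & Hv & Hn).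
    exists v, (S j'). repeat split; auto; try lia. econstructor; eauto.
Qed.

Lemma eval_delta K f M n : delta K f ->
  (eval (App K M) n <-> exists v, eval M v /\ f v = Some n).
Proof.
  intros HK; split.
  - intros E. destruct (eval_ev _ _ E) as (b & j & E').
    destruct (ev_delta _ _ _ _ _ _ HK E') as (v & j' & _ & Ev & Hf & _).
    eauto using ev_eval.
  - intros (v & Ev & Hf). eapply eval_delta_intro; eauto.
Qed.

Definition pickz {A} (v : nat) (x y : A) : A := match v with 0 => x | S _ => y end.

Lemma steps_ifz_arg a a' x y : steps a a' -> steps (ifz a x y) (ifz a' x y).
Proof.
  intros H. unfold ifz. do 2 apply steps_app.
  induction H; econstructor; eauto; constructor; auto.
Qed.

Lemma eval_ifz_intro a v x y n : eval a v -> eval (pickz v x y) n -> eval (ifz a x y) n.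
Proof.
  intros Ea E. apply (steps_eval _ _ n (steps_ifz_arg _ _ x y Ea)).
  unfold ifz. destruct v; simpl in E; (eapply eval_step; [constructor|assumption]).
Qed.

Lemma ev_ifz b j a x y n : ev b j (ifz a x y) n ->
  exists v j1 j2, j1 <= j /\ j2 <= j /\ v < b /\ ev b j1 a v /\ ev b j2 (pickz v x y) n.
Proof.
  unfold ifz. revert a. induction j; intros a E; inversion E; subst.
  inversion H0; subst.
  - exists 0, 0, j; repeat split; auto; try lia; constructor; auto.
  - exists (S n0), 0, j; repeat split; auto; try lia; constructor; auto.
  - inversion H4; subst. inversion H5; subst.
    + match goal with H : stepb _ Ifz _ |- _ => inversion H end.
    + destruct (IHj _ H1) as (v & j1 & j2 & ? & ? & ? & ? & ?).
      exists v, (S j1), j2. repeat split; auto; try lia. econstructor; eauto.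
Qed.

Lemma eval_ifz a x y n :
  eval (ifz a x y) n <-> exists v, eval a v /\ eval (pickz v x y) n.
Proof.
  split.
  - intros E. destruct (eval_ev _ _ E) as (b & j & E').
    destruct (ev_ifz _ _ _ _ _ _ E') as (v & j1 & j2 & _ & _ & _ & E1 & E2).
    eauto using ev_eval.
  - intros (v & Ev & E). eapply eval_ifz_intro; eauto.
Qed.

(** * Logical relations *)

(** The range of indices at arrow types builds in monotonicity. Arguments need only be closed, so no
    typing is carried along. *)
Fixpoint Rel (RN : nat -> term -> term -> Prop) (t : ty) (i : nat) (M M' : term) : Prop :=
  match t with
  | N => RN i M M'
  | Arr s t => forall j P P', j <= i -> clo P -> clo P' -> Rel RN s j P P' ->
                 Rel RN t j (App M P) (App M' P')
  end.

(** These closure properties lift from the ground type to all types; expansion does so because a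
    step of [M] is also a step of [App M P]. *)
Record admissible (RN : nat -> term -> term -> Prop) : Prop := {
  adm_down : forall i j M M', j <= i -> RN i M M' -> RN j M M';
  adm_expL : forall i M M1 M', step M M1 -> RN i M1 M' -> RN i M M';
  adm_expR : forall i M M' M1', step M' M1' -> RN i M M1' -> RN i M M' }.

Lemma Rel_down RN : admissible RN ->
  forall t i j M M', j <= i -> Rel RN t i M M' -> Rel RN t j M M'.
Proof.
  intros HR [] i j M M' Hj; simpl.
  - apply (adm_down _ HR); auto.
  - intros H j' P P' Hj'. apply H. lia.
Qed.

Lemma Rel_expL RN : admissible RN ->
  forall t i M M1 M', steps M M1 -> Rel RN t i M1 M' -> Rel RN t i M M'.
Proof.
  intros HR t i M M1 M' Hs H.
  assert (H1 : forall t i M M1 M', step M M1 -> Rel RN t i M1 M' -> Rel RN t i M M').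
  { clear - HR. induction t; simpl; intros i M M1 M' Hs H.
    - eapply (adm_expL _ HR); eauto.
    - intros. eapply IHt2; [constructor; eassumption|eauto]. }
  induction Hs; eauto.
Qed.

Lemma Rel_expR RN : admissible RN ->
  forall t i M M' M1', steps M' M1' -> Rel RN t i M M1' -> Rel RN t i M M'.
Proof.
  intros HR t i M M' M1' Hs H.
  assert (H1 : forall t i M M' M1', step M' M1' -> Rel RN t i M M1' -> Rel RN t i M M').
  { clear - HR. induction t; simpl; intros i M M' M1' Hs H.
    - eapply (adm_expR _ HR); eauto.
    - intros. eapply IHt2; [constructor; eassumption|eauto]. }
  induction Hs; eauto.
Qed.

Inductive envrel (RN : nat -> term -> term -> Prop) (i : nat) :
  list ty -> list term -> list term -> Prop :=
| er_nil : envrel RN i [] [] []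
| er_cons : forall t G P P' e e', clo P -> clo P' -> Rel RN t i P P' ->
    envrel RN i G e e' -> envrel RN i (t :: G) (P :: e) (P' :: e').

Lemma envrel_down RN i j G e e' : admissible RN -> j <= i ->
  envrel RN i G e e' -> envrel RN j G e e'.
Proof.
  intros HR Hj. induction 1; constructor; auto. eapply Rel_down; eauto.
Qed.

Lemma envrel_clo RN i G e e' : envrel RN i G e e' -> Forall (bounded 0) e /\ Forall (bounded 0) e'.
Proof. induction 1; intuition. Qed.

Lemma envrel_nth RN i G e e' n t : envrel RN i G e e' -> nth_error G n = Some t ->
  Rel RN t i (nth n e (Num 0)) (nth n e' (Num 0)).
Proof.
  intros H. revert n. induction H; intros [] Hn; simpl in *; try discriminate; auto.
  congruence.
Qed.

Lemma Rel_Lam RN s t i A A' e e' : admissible RN -> Forall (bounded 0) e -> Forall (bounded 0) e' ->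
  (forall j P P', j <= i -> clo P -> clo P' -> Rel RN s j P P' ->
     Rel RN t j (msubst 0 (P :: e) A) (msubst 0 (P' :: e') A')) ->
  Rel RN (Arr s t) i (msubst 0 e (Lam s A)) (msubst 0 e' (Lam s A')).
Proof.
  intros HR He He' H j P P' Hj HP HP' HPP. simpl.
  eapply Rel_expL; [auto|econstructor; [constructor|constructor]|].
  eapply Rel_expR; [auto|econstructor; [constructor|constructor]|].
  rewrite !subst_msubst by auto. auto.
Qed.

Definition consts_rel RN i (c c' : term -> term) : Prop :=
  forall K t, ctype K = Some t -> Rel RN t i (c K) (c' K).

(** Comparing two constant replacements reduces to comparing them on single constants. Taking the
    identity as one of them relates a term to its truncation. *)
Lemma fundamental RN c c' : admissible RN -> const_map c -> const_map c' ->
  forall G M t, has_type G M t -> forall i e e', consts_rel RN i c c' -> envrel RN i G e e' ->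
  Rel RN t i (msubst 0 e (tmap c M)) (msubst 0 e' (tmap c' M)).
Proof.
  intros HR Hc Hc'.
  assert (HK : forall i K t e e', consts_rel RN i c c' -> ctype K = Some t ->
      Rel RN t i (msubst 0 e (c K)) (msubst 0 e' (c' K))).
  { intros i K t e e' Hi HK. rewrite !msubst_clo; eauto using closed_clo. }
  induction 1; intros i e e' Hi He; cbn [tmap]; try (apply HK; auto; reflexivity).
  - simpl. rewrite Nat.sub_0_r. eapply envrel_nth; eauto.
  - destruct (envrel_clo _ _ _ _ _ He).
    apply Rel_Lam; auto. intros j P P' Hj HP HP' HPP. apply IHhas_type.
    + intros K t' HK'. eapply Rel_down; eauto.
    + constructor; auto. eapply envrel_down; eauto.
  - destruct (envrel_clo _ _ _ _ _ He).
    simpl. apply (IHhas_type1 i e e'); auto using bounded_msubst.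
    apply IHhas_type2; auto.
Qed.

Lemma fundamental_closed RN c c' i M t : admissible RN -> const_map c -> const_map c' ->
  consts_rel RN i c c' -> closed t M -> Rel RN t i (tmap c M) (tmap c' M).
Proof.
  intros HR Hc Hc' Hi HM.
  rewrite <- (msubst_clo (tmap c M) 0 []), <- (msubst_clo (tmap c' M) 0 []);
    try (eapply closed_clo, has_type_tmap; eauto).
  eapply fundamental; eauto. constructor.
Qed.

(** * The step-indexed approximation relation *)

(** Only computations on the left with at most [i] steps and numbers below [b] must be matched; the
    computation on the right is unrestricted. *)
Definition LE (b i : nat) (M M' : term) : Prop :=
  forall j n, j <= i -> ev b j M n -> eval M' n.

Definition Le (t : ty) (M M' : term) : Prop := forall b i, Rel (LE b) t i M M'.

Lemma LE_adm b : admissible (LE b).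
Proof.
  split; unfold LE.
  - intros i j M M' Hj H j' n Hj'. apply H. lia.
  - intros i M M1 M' Hs H j n Hj E.
    destruct (ev_step_inv _ _ _ _ _ Hs E) as (j' & -> & E'). eapply H; [|eassumption]. lia.
  - intros i M M' M1' Hs H j n Hj E. apply (eval_step _ _ _ Hs). eauto.
Qed.

Lemma LE_down b i j M M' : LE b i M M' -> j <= i -> LE b j M M'.
Proof. intros H Hj. exact (adm_down _ (LE_adm b) i j M M' Hj H). Qed.

(** A computation from [M] spends its first step on reaching [M1], so [M1] is only observed at
    smaller indices. Hence an unfolding on the left pays for an induction on the index. *)
Lemma LE_step b t : forall i M M1 M', step M M1 ->
  (forall j, j < i -> Rel (LE b) t j M1 M') -> Rel (LE b) t i M M'.
Proof.
  induction t; simpl; intros i M M1 M' Hs H.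
  - intros j n Hj E. destruct (ev_step_inv _ _ _ _ _ Hs E) as (j' & -> & E').
    apply (H j' Hj j' n); auto.
  - intros j P P' Hj HP HP' HPP. eapply IHt2; [constructor; eassumption|].
    intros j' Hj'. apply (H j' (Nat.lt_le_trans _ _ _ Hj' Hj) j'); auto. eapply Rel_down; [apply LE_adm| |eassumption]; lia.
Qed.

Lemma LE_delta K f K' f' b i : delta K f -> delta K' f' ->
  (forall v n, v < b -> n < b -> f v = Some n -> f' v = Some n) ->
  Rel (LE b) (Arr N N) i K K'.
Proof.
  intros HK HK' Hf j P P' Hj HP HP' HPP k n Hk E.
  destruct (ev_delta _ _ _ _ _ _ HK E) as (v & k' & Hk' & Ev & Hv & ? & ?).
  apply (eval_delta _ _ _ _ HK'). exists v. split; auto.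
  apply (HPP k' v); auto. lia.
Qed.

Lemma LE_ifz b i a x y a' x' y' : LE b i a a' -> LE b i x x' -> LE b i y y' ->
  LE b i (ifz a x y) (ifz a' x' y').
Proof.
  intros Ha Hx Hy j n Hj E.
  destruct (ev_ifz _ _ _ _ _ _ E) as (v & j1 & j2 & ? & ? & _ & E1 & E2).
  apply eval_ifz. exists v. split.
  - apply (Ha j1); auto; lia.
  - destruct v; [apply (Hx j2)|apply (Hy j2)]; auto; lia.
Qed.

Lemma LE_Fix b t i : Rel (LE b) (Arr (Arr t t) t) i (Fix t) (Fix t).
Proof.
  intros j F F' Hj HF HF' HFF. clear Hj.
  (* Well-founded induction on the index: the recursive call [App (Fix t) F] is passed to [F] at an
     index strictly below [j']. *)
  enough (forall j', j' <= j -> Rel (LE b) t j' (App (Fix t) F) (App (Fix t) F')) by auto.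
  induction j' as [j' IH] using lt_wf_ind. intros Hj'.
  eapply LE_step; [constructor|]. intros l Hl.
  eapply Rel_expR; [apply LE_adm|econstructor; [constructor|constructor]|].
  apply HFF; simpl; auto; try lia. apply IH; lia.
Qed.

Lemma LE_consts_refl b i : consts_rel (LE b) i (fun K => K) (fun K => K).
Proof.
  intros K t H; destruct K; inversion H; subst; clear H.
  - intros j m _ E. eapply ev_eval; eauto.
  - eapply LE_delta; try constructor; auto.
  - eapply LE_delta; try constructor; auto.
  - intros j1 a a' Hj1 _ _ Ha j2 x x' Hj2 _ _ Hx j3 y y' Hj3 _ _ Hy.
    exact (LE_ifz b j3 _ _ _ _ _ _
             (LE_down _ _ _ _ _ Ha (Nat.le_trans _ _ _ Hj3 Hj2)) (LE_down _ _ _ _ _ Hx Hj3) Hy).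
  - apply LE_Fix.
  - eapply LE_delta; try constructor; auto.
Qed.

Lemma Le_refl t M : closed t M -> Le t M M.
Proof.
  intros H b i. rewrite <- (tmap_id M).
  apply fundamental_closed; auto using LE_adm, const_map_id, LE_consts_refl.
Qed.

Lemma Le_app s t M M' P P' : closed s P -> closed s P' ->
  Le (Arr s t) M M' -> Le s P P' -> Le t (App M P) (App M' P').
Proof.
  intros HP HP' HM HPP b i. apply (HM b i); eauto using closed_clo.
  apply HPP.
Qed.

Lemma Le_eval M M' n : Le N M M' -> eval M n -> eval M' n.
Proof.
  intros H E. destruct (eval_ev _ _ E) as (b & j & E'). eapply H; eauto.
Qed.

Lemma Le_ext_le s M M' : closed s M -> closed s M' -> Le s M M' -> ext_le s M M'.
Proof.
  intros HM HM' H h Hh n. apply Le_eval. eapply Le_app; eauto using Le_refl.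
Qed.

(** * Truncation *)

(** [None] stands for divergence and [Some w] for the number [w], so both kinds of truncation share
    their definitions. *)
Definition bot (o : option nat) : term :=
  match o with None => App (Cst (fun _ => None)) (Num 0) | Some w => Num w end.

Fixpoint botT (o : option nat) (t : ty) : term :=
  match t with N => bot o | Arr s t => Lam s (botT o t) end.

(** The default also replaces undefined values of [f]. With [o = Some m] the result is therefore
    total, and it sends [m] to [m]. *)
Definition cut (o : option nat) (m : nat) (f : nat -> option nat) (x : nat) : option nat :=
  if x <? m then
    match f x with Some y => if y <? m then Some y else o | None => o end
  else o.

Definition small (m x : nat) : option nat := Some (if x <? m then 0 else 1).

Fixpoint iter (m : nat) (F X : term) : term :=
  match m with 0 => X | S m => App F (iter m F X) end.

(** The conditional first tests whether its condition is below [m]; without this guard the default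
    [m] would select the nonzero branch instead of propagating. *)
Definition trunc_const (o : option nat) (m : nat) (K : term) : term :=
  match K with
  | Num n => if n <? m then Num n else bot o
  | Suc => Cst (cut o m (fun n => Some (S n)))
  | Pre => Cst (cut o m (fun n => Some (pred n)))
  | Cst f => Cst (cut o m f)
  | Ifz => Lam N (Lam N (Lam N
      (ifz (App (Cst (small m)) (Var 2)) (ifz (Var 2) (Var 1) (Var 0)) (bot o))))
  | Fix t => Lam (Arr t t) (iter m (Var 0) (botT o t))
  | K => K
  end.

Definition trunc o m := tmap (trunc_const o m).

Lemma bot_type o G : has_type G (bot o) N.
Proof. destruct o; simpl; repeat econstructor. Qed.

Lemma botT_type o t : forall G, has_type G (botT o t) t.
Proof. induction t; intros; simpl; [apply bot_type|constructor; auto]. Qed.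

Lemma iter_type G t m F X : has_type G F (Arr t t) -> has_type G X t -> has_type G (iter m F X) t.
Proof. intros; induction m; simpl; auto. econstructor; eauto. Qed.

Lemma trunc_const_map o m : const_map (trunc_const o m).
Proof.
  intros K t H; destruct K; inversion H; subst; clear H; simpl; try constructor.
  - destruct (n <? m); [constructor|apply bot_type].
  - unfold ifz. repeat (econstructor; try apply bot_type).
  - apply iter_type; [constructor; reflexivity|apply botT_type].
Qed.

Lemma trunc_type o m t M : closed t M -> closed t (trunc o m M).
Proof. apply has_type_tmap, trunc_const_map. Qed.

Lemma bot_diverges n : ~ eval (bot None) n.
Proof.
  intros E. apply (eval_delta _ _ _ _ (delta_cst _)) in E. destruct E as (? & _ & ?).
  discriminate.
Qed.

Lemma steps_trunc_ifz o m a x y : clo a -> clo x -> clo y ->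
  steps (App (App (App (trunc_const o m Ifz) a) x) y)
        (ifz (App (Cst (small m)) a) (ifz a x y) (bot o)).
Proof.
  intros Ha Hx Hy. econstructor; [do 2 constructor; constructor|].
  econstructor; [simpl; do 1 constructor; constructor|].
  econstructor; [simpl; constructor|]. simpl.
  assert (Hb : forall k P, subst k P (bot o) = bot o) by (destruct o; reflexivity).
  rewrite !Hb. rewrite !(bounded_lift a 0), !(bounded_lift x 0), !(bounded_lift y 0), !(bounded_subst a 0),
    !(bounded_subst x 0) by (auto; lia).
  constructor.
Qed.

Lemma steps_trunc_Fix o m t F : clo F ->
  steps (App (trunc_const o m (Fix t)) F) (iter m F (botT o t)).
Proof.
  intros HF. econstructor; [constructor|].
  replace (subst 0 F (iter m (Var 0) (botT o t))) with (iter m F (botT o t)); [constructor|].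
  induction m; simpl.
  - symmetry. eapply bounded_subst; [eapply closed_clo, botT_type|lia].
  - rewrite (bounded_lift _ 0) by (auto; lia). congruence.
Qed.

Lemma clo_iter m F X : clo F -> clo X -> clo (iter m F X).
Proof. intros; induction m; simpl; auto. Qed.

Lemma Rel_iter RN t i m F F' X X' : clo F -> clo F' -> clo X -> clo X' ->
  Rel RN (Arr t t) i F F' -> Rel RN t i X X' -> Rel RN t i (iter m F X) (iter m F' X').
Proof.
  intros HF HF' HX HX' H HXX. induction m; simpl; auto.
  apply H; auto using clo_iter.
Qed.

Lemma clo_botT o t : clo (botT o t).
Proof. eapply closed_clo, botT_type. Qed.

(** Stated for terms that reduce to [botT None t], because applying such a term to an argument
    leaves a redex and not [botT] itself. *)
Lemma LE_botT b t : forall i M M', steps M (botT None t) -> Rel (LE b) t i M M'.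
Proof.
  induction t; intros i M M' Hs.
  - eapply Rel_expL; [apply LE_adm|eassumption|]. intros j n _ E.
    destruct (bot_diverges n). eapply ev_eval; eauto.
  - intros j P P' Hj HP HP' _. apply IHt2.
    eapply steps_trans; [apply steps_app; eassumption|]. simpl.
    econstructor; [constructor|].
    erewrite bounded_subst; [constructor|apply clo_botT|lia].
Qed.

Lemma cut_None m f v n : cut None m f v = Some n <-> v < m /\ n < m /\ f v = Some n.
Proof.
  unfold cut. destruct (Nat.ltb_spec v m); [|split; [discriminate|lia]].
  destruct (f v) as [y|]; [|split; [discriminate|intros (_ & _ & E); discriminate]].
  destruct (Nat.ltb_spec y m).
  - split; [|tauto]. intros E; injection E as ->. auto.
  - split; [discriminate|]. intros (_ & Hn & E). injection E as ->. lia.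
Qed.

Lemma cut_le o m f v n : cut None m f v = Some n -> cut o m f v = Some n.
Proof.
  intros H. apply cut_None in H. destruct H as (Hv & Hn & Hf). unfold cut.
  rewrite Hf. apply Nat.ltb_lt in Hv, Hn. rewrite Hv, Hn. reflexivity.
Qed.

Lemma small_spec m a v : eval (App (Cst (small m)) a) v <->
  (exists x, eval a x /\ v = if x <? m then 0 else 1).
Proof.
  rewrite (eval_delta _ _ _ _ (delta_cst _)). unfold small.
  split; intros (x & Hx & E); exists x; split; auto; congruence.
Qed.

(** * Truncations under the approximation relation *)

Lemma LE_trunc_below b i m : consts_rel (LE b) i (trunc_const None m) (fun K => K).
Proof.
  intros K t H; destruct K; inversion H; subst; clear H; cbn [trunc_const].
  - destruct (n <? m); intros j k _ E; apply ev_eval in E; auto. destruct (bot_diverges _ E).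
  - eapply LE_delta; try constructor. intros v n _ _ Hc. apply cut_None in Hc; tauto.
  - eapply LE_delta; try constructor. intros v n _ _ Hc. apply cut_None in Hc; tauto.
  - intros j1 a a' Hj1 ? ? Ha j2 x x' Hj2 ? ? Hx j3 y y' Hj3 ? ? Hy.
    eapply Rel_expL; [apply LE_adm|apply (steps_trunc_ifz None m a x y); auto|].
    intros j n Hj E.
    destruct (ev_ifz _ _ _ _ _ _ E) as (v & k1 & k2 & ? & ? & _ & _ & E2).
    (* A nonzero outcome of the size test selects divergence, so the inner conditional must have
       been run. *)
    destruct v; simpl in E2; [|apply ev_eval, bot_diverges in E2; tauto].
    refine (LE_ifz b j3 _ _ _ _ _ _
             (LE_down _ _ _ _ _ Ha (Nat.le_trans _ _ _ Hj3 Hj2)) (LE_down _ _ _ _ _ Hx Hj3) Hy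
             k2 n _ E2). lia.
  - intros j F F' Hj HF HF' HFF.
    eapply Rel_expL; [apply LE_adm|apply (steps_trunc_Fix None m t0 F); auto|].
    clear Hj. induction m; simpl.
    + apply LE_botT. constructor.
    + eapply Rel_expR; [apply LE_adm|econstructor; [constructor|constructor]|].
      apply HFF; simpl; auto using clo_iter, clo_botT.
  - eapply LE_delta; try constructor. intros v n _ _ Hc. apply cut_None in Hc; tauto.
Qed.

Lemma LE_trunc_default b i m o :
  consts_rel (LE b) i (trunc_const None m) (trunc_const o m).
Proof.
  intros K t H; destruct K; inversion H; subst; clear H; cbn [trunc_const];
    try (eapply LE_delta; try constructor; intros v n _ _; apply cut_le).
  - destruct (n <? m); intros j k _ E; apply ev_eval in E; auto. destruct (bot_diverges _ E).
  - intros j1 a a' Hj1 ? ? Ha j2 x x' Hj2 ? ? Hx j3 y y' Hj3 ? ? Hy.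
    eapply Rel_expL; [apply LE_adm|apply (steps_trunc_ifz None m a x y); auto|].
    eapply Rel_expR; [apply LE_adm|apply (steps_trunc_ifz o m a' x' y'); auto|].
    pose proof (LE_down _ _ _ _ _ Ha (Nat.le_trans _ _ _ Hj3 Hj2)).
    pose proof (LE_down _ _ _ _ _ Hx Hj3).
    apply LE_ifz.
    + apply (LE_delta _ (small m) _ (small m) b j3); try constructor; auto.
    + apply LE_ifz; auto.
    + apply (LE_botT b N). constructor.
  - intros j F F' Hj HF HF' HFF.
    eapply Rel_expL; [apply LE_adm|apply (steps_trunc_Fix None m t0 F); auto|].
    eapply Rel_expR; [apply LE_adm|apply (steps_trunc_Fix o m t0 F'); auto|].
    apply Rel_iter; auto using clo_botT. apply LE_botT. constructor.
Qed.

(** Numbers below [b] are never cut when [b <= m], and a computation of at most [i <= m] steps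
    unfolds a fixed point at most [m] times. *)
Lemma LE_trunc_above b i m : b <= m -> i <= m ->
  consts_rel (LE b) i (fun K => K) (trunc_const None m).
Proof.
  intros Hb Hi K t H; destruct K; inversion H; subst; clear H; cbn [trunc_const];
    try (eapply LE_delta; try constructor; intros v n Hv Hn Hf; apply cut_None;
         repeat split; auto; lia).
  - intros j k _ E. inversion E; subst; [|inversion H].
    destruct (Nat.ltb_spec k m); [constructor|lia].
  - intros j1 a a' Hj1 ? ? Ha j2 x x' Hj2 ? ? Hx j3 y y' Hj3 ? ? Hy.
    eapply Rel_expR; [apply LE_adm|apply (steps_trunc_ifz None m a' x' y'); auto|].
    intros j n Hj E.
    destruct (ev_ifz _ _ _ _ _ _ E) as (v & k1 & k2 & ? & ? & Hv & E1 & E2).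
    assert (E1' : eval a' v) by (apply (Ha k1); auto; lia).
    apply eval_ifz. exists 0. split.
    + apply small_spec. exists v. split; auto. destruct (Nat.ltb_spec v m); auto; lia.
    + simpl. apply eval_ifz. exists v. split; auto.
      destruct v; [apply (Hx k2)|apply (Hy k2)]; auto; lia.
  - intros j F F' Hj HF HF' HFF.
    eapply Rel_expR; [apply LE_adm|apply (steps_trunc_Fix None m t0 F'); auto|].
    (* Unfoldings and index decrease together. With no unfolding left the index is 0, and a
       reducible term does not finish in 0 steps. *)
    assert (Hjm : j <= m) by lia. clear Hi Hb Hj. revert j HFF Hjm.
    induction m; intros j HFF Hjm; (eapply LE_step; [constructor|]); intros l Hl; [lia|].
    simpl. apply HFF; simpl; auto using clo_iter, clo_botT; try lia.
    apply IHm; [|lia]. eapply Rel_down; [apply LE_adm| |eassumption]. lia.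
Qed.

Lemma Le_trunc_below m t M : closed t M -> Le t (trunc None m M) M.
Proof.
  intros H b i. rewrite <- (tmap_id M) at 2.
  apply fundamental_closed; auto using LE_adm, const_map_id, trunc_const_map, LE_trunc_below.
Qed.

Lemma Le_trunc_default o m t M : closed t M -> Le t (trunc None m M) (trunc o m M).
Proof.
  intros H b i.
  apply fundamental_closed; auto using LE_adm, trunc_const_map, LE_trunc_default.
Qed.

(** A given computation has a finite length [j] and a number bound [b], and any [m] above [b + j]
    leaves it intact. *)
Lemma eval_trunc M n : closed N M -> eval M n ->
  exists m0, forall m, m0 <= m -> eval (trunc None m M) n.
Proof.
  intros HM E. destruct (eval_ev _ _ E) as (b & j & E'). exists (b + j). intros m Hm.
  assert (H : Rel (LE b) N j M (trunc None m M)).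
  { rewrite <- (tmap_id M) at 1.
    apply fundamental_closed; auto using LE_adm, const_map_id, trunc_const_map.
    apply LE_trunc_above; lia. }
  apply (H j); auto.
Qed.

(** * Divergence made visible by the default value *)

(* Divergence on the left corresponds to the otherwise unused value [m] on the right. *)
Definition marked (m i : nat) (M M' : term) : Prop :=
  (forall n, eval M n -> n < m /\ eval M' n) /\ ((forall n, ~ eval M n) -> eval M' m).

Lemma marked_adm m : admissible (marked m).
Proof.
  split; unfold marked.
  - auto.
  - intros i M M1 M' Hs [H1 H2]. split.
    + intros n E. apply H1. apply (eval_step _ _ _ Hs). auto.
    + intros H. apply H2. intros n E. apply (H n). apply (eval_step _ _ _ Hs). auto.
  - intros i M M' M1' Hs [H1 H2]. split.
    + intros n E. rewrite (eval_step _ _ _ Hs). auto.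
    + intros H. rewrite (eval_step _ _ _ Hs). auto.
Qed.

Lemma marked_val m i M M' : marked m i M M' ->
  (exists v, v < m /\ eval M v /\ eval M' v) \/ ((forall v, ~ eval M v) /\ eval M' m).
Proof.
  intros [H1 H2]. destruct (classic (exists v, eval M v)) as [[v E]|Hn].
  - left. exists v. destruct (H1 v E). auto.
  - right. assert (forall v, ~ eval M v) by firstorder. auto.
Qed.

Lemma marked_same m i M M' n : n < m -> eval M n -> eval M' n -> marked m i M M'.
Proof.
  intros Hn E E'. split.
  - intros k Ek. rewrite (eval_fun _ _ _ Ek E). auto.
  - intros H. destruct (H n E).
Qed.

Lemma marked_div m i M M' : (forall n, ~ eval M n) -> eval M' m -> marked m i M M'.
Proof. intros H E. split; auto. intros n En. destruct (H n En). Qed.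

(** There are three ways to proceed: an argument and result below [m] agree on both sides; a proper
    argument without admissible result gives divergence against [m]; a divergent argument
    corresponds to [m], which is cut off and yields [m] again. *)
Lemma marked_cut m i f : Rel (marked m) (Arr N N) i (Cst (cut None m f)) (Cst (cut (Some m) m f)).
Proof.
  intros j P P' Hj HP HP' HPP. simpl.
  destruct (marked_val m j _ _ HPP) as [(v & Hv & E & E')|[HD E']].
  - destruct (cut None m f v) as [y|] eqn:Hy.
    + apply (marked_same m j _ _ y).
      * apply cut_None in Hy; tauto.
      * eapply eval_delta_intro; eauto; constructor.
      * eapply eval_delta_intro; [constructor|eauto|]. apply cut_le; auto.
    + apply marked_div.
      * intros n En. apply (eval_delta _ _ _ _ (delta_cst _)) in En.
        destruct En as (v' & Ev' & Hv'). rewrite (eval_fun _ _ _ Ev' E) in Hv'. congruence.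
      * eapply eval_delta_intro; [constructor|eauto|].
        unfold cut in *. destruct (v <? m); auto. destruct (f v) as [y|]; auto.
        destruct (y <? m); auto. discriminate.
  - apply marked_div.
    + intros n En. apply (eval_delta _ _ _ _ (delta_cst _)) in En.
      destruct En as (v' & Ev' & Hv'). destruct (HD _ Ev').
    + eapply eval_delta_intro; [constructor|eauto|]. unfold cut. rewrite Nat.ltb_irrefl. auto.
Qed.

Lemma marked_botT m t : forall i M M', steps M (botT None t) -> steps M' (botT (Some m) t) ->
  Rel (marked m) t i M M'.
Proof.
  induction t; intros i M M' Hs Hs'.
  - apply marked_div; auto. intros n E. apply (steps_eval _ _ n Hs) in E.
    destruct (bot_diverges _ E).
  - intros j P P' Hj HP HP' _. apply IHt2;
      (eapply steps_trans; [apply steps_app; eassumption|]; simpl;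
       econstructor; [constructor|];
       erewrite bounded_subst; [constructor|apply clo_botT|lia]).
Qed.

Lemma marked_trunc m i : consts_rel (marked m) i (trunc_const None m) (trunc_const (Some m) m).
Proof.
  intros K t H; destruct K; inversion H; subst; clear H; cbn [trunc_const];
    try apply marked_cut.
  - destruct (Nat.ltb_spec n m).
    + apply (marked_same m i _ _ n); auto; constructor.
    + apply (marked_botT m N); constructor.
  - intros j1 a a' Hj1 ? ? Ha j2 x x' Hj2 ? ? Hx j3 y y' Hj3 ? ? Hy.
    eapply Rel_expL; [apply marked_adm|apply (steps_trunc_ifz None m a x y); auto|].
    eapply Rel_expR; [apply marked_adm|apply (steps_trunc_ifz (Some m) m a' x' y'); auto|].
    simpl.
    destruct (marked_val m j1 _ _ Ha) as [(v & Hv & E & E')|[HD E']].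
    + assert (Hp : marked m j3 (pickz v x y) (pickz v x' y')) by (destruct v; auto).
      apply Nat.ltb_lt in Hv.
      (* When the condition has a value below [m], the guard is passed on both sides and only the
         selected branches remain to be compared. *)
      assert (HE : forall a x y o, eval a v ->
          forall n, eval (ifz (App (Cst (small m)) a) (ifz a x y) (bot o)) n <->
                    eval (pickz v x y) n).
      { clear - Hv. intros a x y o E n. rewrite eval_ifz. split.
        - intros (u & Eu & En). apply small_spec in Eu. destruct Eu as (z & Ez & Hu).
          rewrite (eval_fun _ _ _ Ez E), Hv in Hu. subst u. simpl in En.
          apply eval_ifz in En. destruct En as (u & Eu & En).
          rewrite (eval_fun _ _ _ Eu E) in En. auto.
        - intros En. exists 0. split.
          + apply small_spec. exists v. rewrite Hv. auto.
          + simpl. apply eval_ifz. eauto. }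
      destruct Hp as [H1' H2']. split.
      * intros n En. apply (HE a x y None) in En; auto. destruct (H1' _ En). split; auto.
        apply (HE a' x' y' (Some m)); auto.
      * intros Hn. apply (HE a' x' y' (Some m)); auto. apply H2'. intros n En.
        apply (Hn n). apply (HE a x y None); auto.
    (* The condition diverges on the left and is [m] on the right, where the guard answers 1 and
       hands over the default [m]. *)
    + apply marked_div.
      * intros n En. apply eval_ifz in En. destruct En as (u & Eu & _).
        apply small_spec in Eu. destruct Eu as (z & Ez & _). destruct (HD _ Ez).
      * apply eval_ifz. exists 1. split; [|constructor].
        apply small_spec. exists m. rewrite Nat.ltb_irrefl. auto.
  - intros j F F' Hj HF HF' HFF.
    eapply Rel_expL; [apply marked_adm|apply (steps_trunc_Fix None m t0 F); auto|].
    eapply Rel_expR; [apply marked_adm|apply (steps_trunc_Fix (Some m) m t0 F'); auto|].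
    (* Truncated fixed points are finite iterates, so an induction on [m] starting from the defaults
       suffices and no limit is involved. *)
    apply Rel_iter; auto using clo_botT. apply marked_botT; constructor.
Qed.

Lemma trunc_diverges m M : closed N M -> (forall n, ~ eval (trunc None m M) n) ->
  eval (trunc (Some m) m M) m.
Proof.
  intros HM HD.
  assert (H : Rel (marked m) N 0 (trunc None m M) (trunc (Some m) m M))
    by (apply fundamental_closed; auto using marked_adm, trunc_const_map, marked_trunc).
  apply H. exact HD.
Qed.

(** * Finite procedures survive truncation *)

Lemma nsp_p_nested_ind (P : nsp_e -> Prop) (Q : nsp_p -> Prop) :
  P EBot -> (forall n, P (ENum n)) ->
  (forall x qs brs, Forall Q qs -> Forall (fun br => P (snd br)) brs -> P (ECase x qs brs)) ->
  (forall ts e, P e -> Q (PLam ts e)) ->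
  forall p, Q p.
Proof.
  intros HBot HNum HCase HLam.
  exact (fix ind_e (e : nsp_e) : P e :=
    match e with
    | EBot => HBot
    | ENum n => HNum n
    | ECase x qs brs =>
        HCase x qs brs
          ((fix goq l : Forall Q l :=
              match l with
              | [] => Forall_nil _
              | q :: r => Forall_cons q (ind_p q) (goq r)
              end) qs)
          ((fix go l : Forall (fun br => P (snd br)) l :=
              match l with
              | [] => Forall_nil _
              | (i, e') :: r => Forall_cons (i, e') (ind_e e' : P (snd (i, e'))) (go r)
              end) brs)
    end
  with ind_p (p : nsp_p) : Q p :=
    match p with PLam ts e => HLam ts e (ind_e e) end
  for ind_p).
Qed.

(** [branches] and [spine] name the two anonymous recursions inside [tr_e], so that inductions can
    refer to them. *)
Fixpoint branches (brs : list (nat * nsp_e)) : term :=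
  match brs with
  | [] => omega
  | (i, e) :: r => ifz (App (Cst (eqf i)) (Var 0)) (lift 1 0 (tr_e e)) (branches r)
  end.

Fixpoint spine (qs : list nsp_p) (acc : term) : term :=
  match qs with [] => acc | q :: r => spine r (App acc (tr_p q)) end.

Lemma tr_e_case x qs brs :
  tr_e (ECase x qs brs) = App (Lam N (branches brs)) (spine qs (Var x)).
Proof. reflexivity. Qed.

(** Here one [m] serves all [b] and [i], in contrast to [LE_trunc_above]. This fails for single
    constants such as [Suc], so it is proved along the structure of procedures and not through
    [fundamental]. *)
Definition trunc_sim (m : nat) (M : term) : Prop :=
  forall G t, has_type G M t -> forall b i e e', envrel (LE b) i G e e' ->
    Rel (LE b) t i (msubst 0 e M) (msubst 0 e' (trunc None m M)).

Lemma trunc_sim_Var m n : trunc_sim m (Var n).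
Proof.
  intros G t H b i e e' He. inversion H; subst. simpl. rewrite Nat.sub_0_r.
  eapply envrel_nth; eauto.
Qed.

Lemma trunc_sim_App m M P : trunc_sim m M -> trunc_sim m P -> trunc_sim m (App M P).
Proof.
  intros HM HP G t H b i e e' He. inversion H; subst.
  destruct (envrel_clo _ _ _ _ _ He). simpl.
  apply (HM G (Arr s t) H3 b i e e' He i); auto using bounded_msubst. eapply HP; eauto.
Qed.

Lemma trunc_sim_Lam m t M : trunc_sim m M -> trunc_sim m (Lam t M).
Proof.
  intros HM G t' H b i e e' He. inversion H; subst.
  destruct (envrel_clo _ _ _ _ _ He).
  apply Rel_Lam; auto using LE_adm. intros j P P' Hj HP HP' HPP.
  eapply HM; eauto. constructor; auto. eapply envrel_down; eauto using LE_adm.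
Qed.

Lemma trunc_sim_Num m n : n < m -> trunc_sim m (Num n).
Proof.
  intros Hn G t H b i e e' He. inversion H; subst.
  unfold trunc. cbn [tmap trunc_const].
  apply Nat.ltb_lt in Hn. rewrite Hn. intros j k _ E. eapply ev_eval; eauto.
Qed.

Lemma omega_diverges b j n : ~ ev b j omega n.
Proof.
  induction j as [j IH] using lt_wf_ind. intros E.
  destruct (ev_step_inv _ _ _ _ _ (S_fix N (Lam N (Var 0))) E) as (j1 & -> & E1).
  destruct (ev_step_inv _ _ _ _ _ (S_beta N (Var 0) omega) E1) as (j2 & -> & E2).
  apply (IH j2); auto; lia.
Qed.

Lemma trunc_sim_omega m : trunc_sim m omega.
Proof.
  intros G t H b i e e' He. inversion H; subst. inversion H3; subst.
  intros j n _ E. destruct (omega_diverges _ _ _ E).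
Qed.

Lemma trunc_sim_spine m qs : Forall (fun q => trunc_sim m (tr_p q)) qs ->
  forall acc, trunc_sim m acc -> trunc_sim m (spine qs acc).
Proof. induction 1; simpl; auto using trunc_sim_App. Qed.

Lemma eqf_spec l a v u : eval a v -> eval (App (Cst (eqf l)) a) u ->
  u = if v =? l then 0 else 1.
Proof.
  intros Ea E. apply (eval_delta _ _ _ _ (delta_cst _)) in E. destruct E as (v' & Ev & H).
  rewrite (eval_fun _ _ _ Ev Ea) in H. unfold eqf in H. congruence.
Qed.

(** A scrutinee value that matches no label runs through the whole cascade of tests into [omega].
    Termination thus bounds this value by the labels. *)
Lemma ev_branches_label b a e brs : forall j n, ev b j (msubst 0 (a :: e) (branches brs)) n ->
  exists v j', j' <= j /\ ev b j' a v /\ In v (map fst brs).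
Proof.
  induction brs as [|[l e1] brs IH]; simpl; intros j n E.
  - destruct (omega_diverges _ _ _ E).
  - destruct (ev_ifz _ _ _ _ _ _ E) as (u & j1 & j2 & ? & ? & _ & E1 & E2).
    destruct u; simpl in E2.
    + destruct (ev_delta _ _ _ _ _ _ (delta_cst _) E1) as (v & j' & ? & Ev & Hf & _).
      exists v, j'. repeat split; auto; [lia|]. unfold eqf in Hf.
      destruct (Nat.eqb_spec v l); [auto|discriminate].
    + destruct (IH _ _ E2) as (v & j' & ? & ? & ?). exists v, j'. repeat split; auto; lia.
Qed.

Lemma ifz_type_inv G a x y t : has_type G (ifz a x y) t ->
  t = N /\ has_type G a N /\ has_type G x N /\ has_type G y N.
Proof.
  unfold ifz. intros H.
  repeat match goal with
  | H : has_type _ (App _ _) _ |- _ => inversion H; clear H; subst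
  | H : has_type _ Ifz _ |- _ => inversion H; clear H; subst
  end; auto.
Qed.

Lemma trunc_sim_branches_at m b i G a a' e e' v : 1 < m -> v < m -> eval a v -> eval a' v ->
  clo a' -> envrel (LE b) i G e e' ->
  forall brs, Forall (fun br => trunc_sim m (tr_e (snd br))) brs ->
  has_type (N :: G) (branches brs) N ->
  LE b i (msubst 0 (a :: e) (branches brs)) (msubst 0 (a' :: e') (trunc None m (branches brs))).
Proof.
  intros Hm Hv Ea Ea' Hca He brs Hbrs.
  destruct (envrel_clo _ _ _ _ _ He) as [Hce Hce'].
  induction Hbrs as [|[l e1] brs H1 Hbrs IH]; simpl; intros HT j n Hj E.
  - destruct (omega_diverges _ _ _ E).
  - apply ifz_type_inv in HT. destruct HT as (_ & _ & HT1 & HT2).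
    apply (has_type_lift_inv _ [] N) in HT1. simpl in HT1.
    destruct (ev_ifz _ _ _ _ _ _ E) as (u & j1 & j2 & ? & ? & _ & E1 & E2).
    apply ev_eval in E1. simpl in E1. pose proof (eqf_spec _ _ _ _ Ea E1) as Hu.
    (* The equality test answers 0 or 1, and [1 < m] keeps both answers. *)
    assert (Hum : u < m) by (destruct (v =? l); lia).
    change (eval (App (App (App (trunc_const None m Ifz)
       (App (Cst (cut None m (eqf l))) a'))
       (msubst 0 (a' :: e') (trunc None m (lift 1 0 (tr_e e1)))))
       (msubst 0 (a' :: e') (trunc None m (branches brs)))) n).
    eapply steps_eval; [apply steps_trunc_ifz; simpl; auto using bounded_msubst|].
    assert (Ec : eval (App (Cst (cut None m (eqf l))) a') u).
    { eapply eval_delta_intro; [constructor|eassumption|]. apply cut_None.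
      repeat split; auto. unfold eqf. congruence. }
    apply eval_ifz. exists 0. split.
    + apply small_spec. exists u. split; auto. apply Nat.ltb_lt in Hum. rewrite Hum. auto.
    + simpl. apply eval_ifz. exists u. split; auto. destruct u; simpl in E2 |- *.
      (* The lifted branch does not see the scrutinee value, so the hypothesis on the unlifted
         branch applies in the smaller environment. *)
      * unfold trunc. rewrite lift_tmap by apply trunc_const_map. rewrite msubst_lift in *.
        refine (H1 G N HT1 b i e e' He j2 n _ E2). lia.
      * refine (IH HT2 j2 n _ E2). lia.
Qed.

(** A terminating case has a label as scrutinee value, which is below [m]; from there on truncation
    changes nothing. *)
Lemma trunc_sim_branches m brs : 1 < m -> Forall (fun br => fst br < m) brs ->
  Forall (fun br => trunc_sim m (tr_e (snd br))) brs -> trunc_sim m (branches brs).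
Proof.
  intros Hm Hl Hs G t HT b i e e' He.
  destruct brs as [|[l e1] brs]; [apply (trunc_sim_omega m G); auto|].
  (* The first test applies a constant to [Var 0], so typing forces the context to begin with
     [N]. *)
  assert (HG : exists G', G = N :: G' /\ t = N).
  { apply ifz_type_inv in HT. destruct HT as (-> & HT & _).
    inversion HT as [| |? ? ? ? ? Hc Hv| | | | | |]; subst.
    inversion Hc; subst. inversion Hv; subst.
    destruct G as [|s G]; [discriminate|]. exists G. simpl in *. split; congruence. }
  destruct HG as (G' & -> & ->).
  inversion He as [|? ? P P' e0 e0' HP HP' HPP He0]; subst.
  intros j n Hj E. destruct (ev_branches_label _ _ _ _ _ _ E) as (v & j' & Hj' & Ev & Hv).
  assert (Hvm : v < m).
  { apply in_map_iff in Hv. destruct Hv as (br & <- & Hbr).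
    rewrite Forall_forall in Hl. auto. }
  assert (Ev' : eval P' v) by (apply (HPP j'); auto; lia).
  eapply (trunc_sim_branches_at m b i G' P P'); eauto using ev_eval.
Qed.

Lemma eventually_Forall {A} (R : nat -> A -> Prop) l :
  Forall (fun x => exists m0, forall m, m0 <= m -> R m x) l ->
  exists m0, forall m, m0 <= m -> Forall (R m) l.
Proof.
  induction 1 as [|x l [m1 H1] _ [m2 H2]].
  - exists 0. auto.
  - exists (m1 + m2). intros m Hm. constructor; [apply H1|apply H2]; lia.
Qed.

Lemma trunc_sim_nsp p : exists m0, forall m, m0 <= m -> trunc_sim m (tr_p p).
Proof.
  revert p. apply (nsp_p_nested_ind
    (fun e => exists m0, forall m, m0 <= m -> trunc_sim m (tr_e e))).
  - exists 0. intros. apply trunc_sim_omega.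
  - intros n. exists (S n). intros. apply trunc_sim_Num. lia.
  - intros x qs brs Hq Hb.
    destruct (eventually_Forall _ _ Hq) as [m1 H1].
    destruct (eventually_Forall (fun m br => trunc_sim m (tr_e (snd br))) _ Hb) as [m2 H2].
    destruct (eventually_Forall (fun m br => fst br < m) brs) as [m3 H3].
    { apply Forall_forall. intros br _. exists (S (fst br)). lia. }
    (* The summand 2 ensures [1 < m], for the answers of the equality tests. *)
    exists (2 + m1 + m2 + m3). intros m Hm. rewrite tr_e_case. apply trunc_sim_App.
    + apply trunc_sim_Lam, trunc_sim_branches; [lia|apply H3; lia|apply H2; lia].
    + apply trunc_sim_spine; [apply H1; lia|apply trunc_sim_Var].
  - intros ts e [m0 H]. exists m0. intros m Hm. simpl.
    induction ts; simpl; auto using trunc_sim_Lam.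
Qed.

Lemma Le_nsp t p : closed t (tr_p p) ->
  exists m0, forall m, m0 <= m -> Le t (tr_p p) (trunc None m (tr_p p)).
Proof.
  intros Hp. destruct (trunc_sim_nsp p) as [m0 H]. exists m0. intros m Hm b i.
  pose proof (H m Hm [] t Hp b i [] [] (er_nil _ _)) as HR.
  rewrite !msubst_clo in HR; eauto using closed_clo, trunc_type.
Qed.

(** * Incompatible extensions *)

Lemma eval_context s C M n : eval (App (Lam s C) M) n <-> eval (subst 0 M C) n.
Proof. apply eval_step. constructor. Qed.

Lemma ext_le_obseq s f f' :
  ext_le s f f' -> ext_le s f' f -> obseq s f f'.
Proof.
  intros H1 H2 C HC n.
  rewrite <- (eval_context s C f n), <- (eval_context s C f' n).
  split; [apply H1|apply H2]; constructor; auto.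
Qed.

Lemma obseq_ext_le s f f' : closed s f -> closed s f' -> obseq s f f' -> ext_le s f f'.
Proof.
  intros Hf Hf' H h Hh n.
  assert (HC : forall M, clo M -> subst 0 M (App h (Var 0)) = App h M).
  { intros M HM. simpl. f_equal; [|eapply bounded_lift; eauto].
    eapply bounded_subst; [eapply closed_clo; eauto|lia]. }
  rewrite <- (HC f), <- (HC f') by (eapply closed_clo; eauto).
  apply H. econstructor; [apply closed_has_type; eauto|constructor; reflexivity].
Qed.

Lemma obseq_sym s f f' : obseq s f f' -> obseq s f' f.
Proof. intros H C HC n. symmetry. auto. Qed.

(** If a separating [h] had a value at [f], the assumed inequality would make it the value at [f'];
    so [h] diverges at [f]. *)
Lemma not_ext_le_inv s f f' : ext_le s f f' -> ~ ext_le s f' f ->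
  exists h n, closed (Arr s N) h /\ eval (App h f') n /\ forall k, ~ eval (App h f) k.
Proof.
  intros H1 H2. apply NNPP. intros HN. apply H2. intros h Hh n E.
  apply NNPP. intros HE. apply HN. exists h, n. repeat split; auto.
  intros k Ek. apply HE. pose proof (H1 h Hh k Ek) as Ek'.
  rewrite (eval_fun _ _ _ E Ek'). exact Ek.
Qed.

(* The value [m] replaces divergence everywhere in [h] and [p], so it surfaces at top level
   when [h p] diverges, while the computation of [h f'] is left undisturbed. *)
Lemma trunc_separates s p f' h n : closed s p -> closed s f' -> closed (Arr s N) h ->
  eval (App h f') n -> (forall k, ~ eval (App h p) k) ->
  exists m0, forall m, m0 <= m ->
    n < m /\ eval (App (trunc (Some m) m h) f') n /\
    eval (App (trunc (Some m) m h) (trunc (Some m) m p)) m.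
Proof.
  intros Hp Hf' Hh E HD.
  destruct (eval_trunc (App h f') n) as [m0 H]; auto.
  { econstructor; eauto. }
  exists (S n + m0). intros m Hm. split; [lia|split].
  (* Truncation with divergence keeps the value [n]. Changing the default in [h] and restoring [f']
     only go up in [Le]. *)
  - refine (Le_eval _ _ _ _ (H m _)); [|lia].
    change (trunc None m (App h f')) with (App (trunc None m h) (trunc None m f')).
    eapply Le_app; eauto using trunc_type, Le_trunc_default, Le_trunc_below.
  (* The truncation with divergence lies below [App h p], so it diverges as well and the other
     truncation yields [m]. *)
  - apply (trunc_diverges m (App h p)); [econstructor; eauto|].
    intros k Ek. apply (HD k). revert Ek. apply Le_eval, Le_trunc_below. econstructor; eauto.
Qed.

Lemma finite_lt_conflict s f f' : closed s f -> closed s f' -> sf_finite s f -> sf_lt s f f' ->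
  exists f'', closed s f'' /\ sharp s f'' f' /\ sf_lt s f f''.
Proof.
  intros Hf Hf' (np & Hp & Hfp) [Hle Hne].
  destruct (not_ext_le_inv s f f') as (h & n & Hh & E & HD); auto.
  { intros H. apply Hne, ext_le_obseq; auto. }
  destruct (trunc_separates s (tr_p np) f' h n) as [m1 H1]; auto.
  { intros k Ek. apply (HD k). revert Ek.
    apply (obseq_ext_le s (tr_p np) f); auto using obseq_sym. }
  destruct (Le_nsp s np Hp) as [m2 H2].
  specialize (H1 (m1 + m2)). specialize (H2 (m1 + m2)). set (m := m1 + m2) in *.
  destruct H1 as (Hn & E1 & E2); [lia|].
  set (f'' := trunc (Some m) m (tr_p np)) in *.
  assert (Hf'' : closed s f'') by (apply trunc_type; auto).
  assert (Hsharp : sharp s f'' f').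
  { intros (g & Hg & Hg1 & Hg2).
    assert (Hth : closed (Arr s N) (trunc (Some m) m h)) by (apply trunc_type; auto).
    pose proof (eval_fun _ _ _ (Hg1 _ Hth _ E2) (Hg2 _ Hth _ E1)). lia. }
  exists f''. repeat split; auto.
  - intros k Hk j Ek.
    assert (Hm : ext_le s (tr_p np) (trunc None m (tr_p np)))
      by (apply Le_ext_le; auto using trunc_type; apply H2; lia).
    assert (Hm' : ext_le s (trunc None m (tr_p np)) f'')
      by (apply Le_ext_le; [apply trunc_type|..|apply Le_trunc_default]; auto).
    apply Hm', Hm, (obseq_ext_le s f); auto.
  (* If [f''] were equal to [f], then [f'] itself would be an upper bound of [f''] and [f']. *)
  - intros Heq. apply Hsharp. exists f'. repeat split; auto.
    + intros k Hk j Ek. apply Hle; auto.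
      revert Ek. apply (obseq_ext_le s f'' f); auto using obseq_sym.
    + intros k Hk j Ek; exact Ek.
Qed.

Lemma ident_type s : closed (Arr s s) (ident s).
Proof. repeat constructor. Qed.

(* Truncation leaves the identity, which contains no constants, unchanged. *)
Lemma ident_maximal s Phi : closed (Arr s s) Phi -> ext_le (Arr s s) (ident s) Phi ->
  ext_le (Arr s s) Phi (ident s).
Proof.
  intros HPhi Hle. apply NNPP. intros HN.
  destruct (not_ext_le_inv (Arr s s) (ident s) Phi) as (h & n & Hh & E & HD); auto.
  destruct (trunc_separates (Arr s s) (ident s) Phi h n) as [m H]; auto using ident_type.
  destruct (H m) as (Hn & E1 & E2); auto.
  apply Hle in E2; [|apply trunc_type; auto].
  pose proof (eval_fun _ _ _ E1 E2). lia.
Qed.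

(** Evaluation at [a] followed by [h] is itself a test [C] on the function type. *)
Lemma ext_le_app s t f g a : closed (Arr s t) f -> closed (Arr s t) g -> closed s a ->
  ext_le (Arr s t) f g -> ext_le t (App f a) (App g a).
Proof.
  intros Hf Hg Ha H h Hh n.
  set (C := Lam (Arr s t) (App h (App (Var 0) a))).
  assert (HC : forall M, closed (Arr s t) M -> (eval (App C M) n <-> eval (App h (App M a)) n)).
  { intros M HM. unfold C. rewrite (eval_context (Arr s t)). simpl.
    rewrite (bounded_subst h 0), (bounded_subst a 0), (bounded_lift M 0)
      by (solve [eapply closed_clo; eauto | lia]). tauto. }
  rewrite <- !HC by auto. apply H. unfold C. constructor.
  econstructor; [apply closed_has_type; eauto|].
  econstructor; [constructor; reflexivity|apply closed_has_type; auto].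
Qed.

Theorem theoremA1 (k : nat) :
  (forall f f' : term,
      closed (pure k) f -> closed (pure k) f' ->
      sf_finite (pure k) f -> sf_lt (pure k) f f' ->
      exists f'' : term,
        closed (pure k) f'' /\ sharp (pure k) f'' f' /\ sf_lt (pure k) f f'')
  /\
  (forall Phi : term,
      closed (Arr (pure k) (pure k)) Phi ->
      ext_le (Arr (pure k) (pure k)) (ident (pure k)) Phi ->
      (~ exists f : term, closed (pure k) f /\ sf_lt (pure k) f (App Phi f))
      /\ obseq (Arr (pure k) (pure k)) Phi (ident (pure k))).
Proof.
  generalize (pure k) as s. intros s. split; [apply finite_lt_conflict|].
  intros Phi HPhi Hle. pose proof (ident_maximal s Phi HPhi Hle) as Hge.
  split; [|apply ext_le_obseq; auto].
  intros (f & Hf & Hlt & Hne). apply Hne.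
  assert (HPf : closed s (App Phi f)) by (econstructor; eauto).
  assert (Hif : closed s (App (ident s) f)) by (eapply T_App; [apply ident_type|exact Hf]).
  (* It remains to bound [App Phi f] by [f]: maximality of the identity bounds it by
     [App (ident s) f], which reduces to [f]. *)
  apply ext_le_obseq; auto. intros h Hh n E.
  assert (E' : eval (App h (App (ident s) f)) n)
    by (revert E; apply (ext_le_app s s); auto using ident_type).
  revert E'. apply (Le_ext_le s (App (ident s) f) f); auto.
  intros b i. eapply Rel_expL; [apply LE_adm|econstructor; [constructor|constructor]|].
  simpl. rewrite (bounded_lift f 0) by (solve [eapply closed_clo; eauto | lia]).
  apply Le_refl; auto.
Qed.
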